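(* Let $(W,T)$ be a spherical crystallographic dual Coxeter system of rank $n$ and let $P$ be a parabolic subgroup of $W$ of rank $n-1$. Then all the reflections $t\in T$ such that $W=\langle P,t\rangle$ form a single orbit under conjugation by $P$.
   Context: A dual Coxeter system of finite rank $n$ is a pair $(W,T)$ consisting of a group $W$ and a generating subset $T\subseteq W$ such that there is a subset $S\subseteq T$ with $|S|=n$ for which $(W,S)$ is a Coxeter system and $T=\{wsw^{-1}\mid w\in W, s\in S\}$ is its set of reflections. Such an $S$ is called a simple system for $(W,T)$; the rank $n$ is well defined. The system is spherical if $W$ is finite. It is crystallographic if $W$ can be realized as a finite group of orthogonal transformations of a Euclidean space $(V,(\cdot\mid\cdot))$ with $T=\{s_\alpha\mid\alpha\in\Phi\}$, where $s_\alpha(v)=v-\frac{2(\alpha\mid v)}{(\alpha\mid\alpha)}\alpha$ and $\Phi$ is a crystallographic root system in $V$, i.e. a finite set of nonzero vectors spanning $V$ with $s_\alpha(\Phi)=\Phi$, $\Phi\cap\mathbb{R}\alpha=\{\pm\alpha\}$ and $\frac{2(\alpha\mid\beta)}{(\alpha\mid\alpha)}\in\mathbb{Z}$ for all $\alpha,\beta\in\Phi$, and $\dim V=n$. A parabolic subgroup of $W$ of rank $m$ is a subgroup of the form $\langle s_1,\dots,s_m\rangle$ where $\{s_1,\dots,s_n\}$ is some simple system for $(W,T)$ and $m\le n$ (for finite Coxeter groups this coincides with the usual notion: a conjugate of a subgroup generated by an $m$-element subset of a fixed simple system). *)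

(* Defs.v *)
From HB Require Import structures.
From mathcomp Require Import all_boot all_order all_algebra all_fingroup.
From mathcomp Require Import sesquilinear archimedean reals.

Set Implicit Arguments.
Unset Strict Implicit.
Unset Printing Implicit Defensive.

Import Order.TTheory GRing.Theory Num.Theory.

Section CoxeterSystems.
Local Open Scope group_scope.
Variable gT : finGroupType.
Implicit Types (W S T P : {set gT}) (n m : nat).

(* The last clause is the universal property of the presentation
   < S | (s t)^#[s t] = 1 >.  The target hT must range over all groups, finite
   or not.  The values of f off S and of phi off W are irrelevant. *)
Definition coxeter_system W S : Prop :=
  [/\ <<S>> = W,
      {in S, forall s, #[s] = 2}
    & forall (hT : groupType) (f : gT -> hT),
        {in S &, forall s t, (f s * f t) ^+ #[s * t] = 1} ->
        exists phi : gT -> hT,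
          {in W &, {morph phi : x y / x * y}} /\ {in S, phi =1 f}].

Definition simple_system W T n S : Prop :=
  [/\ S \subset T, #|S| = n, coxeter_system W S & T = class_support S W].

Definition dual_coxeter_system W T n : Prop :=
  <<T>> = W /\ exists S, simple_system W T n S.

Definition parabolic_subgroup W T n m P : Prop :=
  exists S J : {set gT},
    [/\ simple_system W T n S, J \subset S, #|J| = m & P = <<J>>].

End CoxeterSystems.

Local Open Scope ring_scope.

Section RootSystems.
Variables (R : realType) (V : vectType R) (form : {dot V for idfun}).

Definition reflection (a v : V) : V := v - (2 * form a v / form a a) *: a.

Definition crystallographic_root_system (Phi : seq V) : Prop :=
  [/\ 0 \notin Phi,
      <<Phi>>%VS = fullv,
      {in Phi, forall a, map (reflection a) Phi =i Phi},
      {in Phi, forall a, [predI Phi & <[a]>%VS] =i [:: a; - a]}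
    & {in Phi &, forall a b, 2 * form a b / form a a \is a Num.int}].

End RootSystems.

Definition crystallographic (R : realType) (gT : finGroupType)
    (W T : {set gT}) (n : nat) : Prop :=
  exists (V : vectType R) (form : {dot V for idfun}) (Phi : seq V)
         (rho : gT -> 'End(V)),
    [/\ \dim {:V} = n /\ crystallographic_root_system form Phi,
        {in W &, forall x y, rho (x * y)%g = (rho x \o rho y)%VF}
          /\ {in W &, injective rho},
        {in W, forall x u v, form (rho x u) (rho x v) = form u v},
        {in T, forall t, exists2 a, a \in Phi & rho t =1 reflection form a}
      & {in Phi, forall a, exists2 t, t \in T & rho t =1 reflection form a}].

(* Main.v *)
Require Import Defs.
From mathcomp Require Import all_boot all_order all_algebra all_fingroup.
From mathcomp Require Import sesquilinear archimedean reals.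
From mathcomp Require Import zify ring lra.

(** Let S = {s} u J be a simple system with P = <J>, realize W as a reflection
group, and let a_x be a root of the reflection x. No positive system is chosen
anywhere; everything rests on the lattices spanned by the a_x and by their
coroots, and on the P-average q of a_s. This q is fixed by P, hence orthogonal
to the a_j with j in J, and (q | a_s) > 0; call (q | v) / (q | a_s) the level
of v.

Every reflection is conjugate to a member of S, so every root is an integral
combination of the a_x, and every coroot one of the coroots of the a_x
([conj_root_zspan], [conj_coroot_zspan]). In particular levels of roots are
integers.

Suppose that t and P generate W. A sign character of W, which the Coxeter
presentation provides, shows that s is conjugate to a member of {t} u J
([reflection_gens_conj]). Hence a_s is an integral combination of a_t and the
a_j, so the level of a_t is 1 or -1; the same argument for coroots then gives
that a_t and a_s have the same length ([generating_root_level]).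

Conversely, roots a, b of level 1 and of the length of a_s are P-conjugate
([level_roots_conj]): both have P-average q, so (w a | w' b) > 0 for some w, w'
in P. Two distinct roots of equal length and with positive scalar product
differ by a root, and the reflection in the difference swaps them. This
difference has level 0, so it remains to see that P contains the reflections in
roots of level 0 ([level0_refl_parabolic]).

Such a root c is an integral combination of the a_j, and its coroot one of
their coroots. Roots nonorthogonal to c are either all at most as long as c or
all at least as long ([minuscule_dichotomy]); replacing the root system by its
dual if necessary, assume that they are at least as long. Write c as a sum of
as few elements of P.{a_j} as possible. One summand x has (x | c) > 0; either
c = x, or reflecting c in x removes the summand x, and induction applies
([zspan_minuscule]). So c lies in P.{a_j}, and its reflection in P. *)

Set Implicit Arguments.
Unset Strict Implicit.
Unset Printing Implicit Defensive.

Import Order.TTheory GRing.Theory Num.Theory.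
Local Open Scope ring_scope.

(** * Integral combinations *)

Section IntegralSpan.
Variable V : zmodType.
Implicit Types (X Y : V -> Prop) (u v : V).

Inductive zspan X : V -> Prop :=
  | zspan_gen x of X x : zspan X x
  | zspan0 : zspan X 0
  | zspanB u v of zspan X u & zspan X v : zspan X (u - v).

Lemma zspanN X v : zspan X v -> zspan X (- v).
Proof. by move=> Xv; rewrite -sub0r; apply: zspanB Xv; exact: zspan0. Qed.

Lemma zspanD X u v : zspan X u -> zspan X v -> zspan X (u + v).
Proof. by move=> Xu Xv; rewrite -[v]opprK; apply/zspanB/zspanN. Qed.

Lemma zspanMz X v (m : int) : zspan X v -> zspan X (v *~ m).
Proof.
move=> Xv; have XvM k : zspan X (v *+ k).
  by elim: k => [|k IH]; [exact: zspan0 | rewrite mulrS; exact: zspanD].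
by case: m => k; rewrite ?NegzE ?mulrNz -pmulrn //; apply: zspanN.
Qed.

Lemma zspan_sub X Y v : (forall x, X x -> zspan Y x) -> zspan X v -> zspan Y v.
Proof.
move=> XY; elim=> [x /XY // | | u w _ Yu _ Yw]; first exact: zspan0.
exact: zspanB.
Qed.

Lemma zspan_coef X Y a v : (forall x, X x -> x = a \/ Y x) -> zspan X v ->
  exists m : int, zspan Y (v - a *~ m).
Proof.
move=> XaY; elim=> [x /XaY[-> | Yx] | | u w _ [m Ym] _ [k Yk]].
- by exists 1; rewrite mulr1z subrr; exact: zspan0.
- by exists 0; rewrite mulr0z subr0; exact: zspan_gen.
- by exists 0; rewrite mulr0z subr0; exact: zspan0.
exists (m - k); rewrite mulrzBr.
have -> : u - w - (a *~ m - a *~ k) = (u - a *~ m) - (w - a *~ k).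
  by rewrite !opprD !opprK addrACA.
exact: zspanB.
Qed.

(** Keeping the summands as a list gives their number, on which
[zspan_minuscule] inducts. *)
Lemma zspan_sum X v : (forall x, X x -> X (- x)) -> zspan X v ->
  exists2 s : seq V, (forall x, x \in s -> X x) & v = \sum_(x <- s) x.
Proof.
move=> XN; elim=> [x Xx | | u w _ [s Xs ->] _ [r Xr ->]].
- by exists [:: x] => [y|]; rewrite ?big_seq1 // inE => /eqP->.
- by exists [::]; rewrite ?big_nil.
exists (s ++ [seq - x | x <- r]); last by rewrite big_cat big_map sumrN.
by move=> x; rewrite mem_cat => /orP[/Xs // | /mapP[y /Xr Xy ->]]; exact: XN.
Qed.

End IntegralSpan.

(** * Reflections and coroots *)

Section Reflections.
Variables (R : realType) (V : vectType R) (form : {dot V for idfun}).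
Implicit Types (a b c u v : V).
Local Notation "''[' u , v ]" := (form u v) : ring_scope.

(** The usual <v, a^vee>: the root comes first, and [pairing a] is linear. *)
Definition pairing a v := 2 * '[a, v] / '[a, a].
Definition coroot a := (2 / '[a, a]) *: a.
Local Notation refl := (reflection form).

Lemma dotC u v : '[u, v] = '[v, u].
Proof. by rewrite (hermC form u v) expr0 mul1r. Qed.

Lemma dotZl k u v : '[k *: u, v] = k * '[u, v]. Proof. exact: linearZl_LR. Qed.
Lemma dotZr k u v : '[u, k *: v] = k * '[u, v]. Proof. exact: linearZ_LR. Qed.

Lemma dotDl u v w : '[u + v, w] = '[u, w] + '[v, w].
Proof. exact: linearDl. Qed.
Lemma dotDr u v w : '[w, u + v] = '[w, u] + '[w, v].
Proof. exact: linearDr. Qed.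
Lemma dotNl u v : '[- u, v] = - '[u, v]. Proof. exact: linearNl. Qed.
Lemma dotNr u v : '[u, - v] = - '[u, v]. Proof. exact: linearNr. Qed.
Lemma dot0l v : '[0, v] = 0. Proof. exact: linear0l. Qed.
Lemma dot0r v : '[v, 0] = 0. Proof. exact: linear0r. Qed.

Definition dotE := (dotDl, dotDr, dotNl, dotNr, dotZl, dotZr, dot0l, dot0r).

Lemma dot_gt0 u : u != 0 -> 0 < '[u, u].
Proof. exact: neq0_dnorm_gt0. Qed.

Lemma dot_neq0 u : u != 0 -> '[u, u] != 0.
Proof. by move/dot_gt0/lt0r_neq0. Qed.

Lemma reflE a v : refl a v = v - pairing a v *: a. Proof. by []. Qed.

Lemma pairingE a v : pairing a v * '[a, a] = 2 * '[a, v].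
Proof.
have [-> | /dot_neq0 nz_a] := eqVneq a 0; last by rewrite /pairing divfK.
by rewrite !dot0l !mulr0.
Qed.

Lemma refl_isometry a u v : '[refl a u, refl a v] = '[u, v].
Proof.
rewrite !reflE !dotE (dotC u a).
have := congr1 ( *%R (pairing a v)) (pairingE a u).
have := congr1 ( *%R (pairing a u)) (pairingE a v).
lra.
Qed.

Lemma pairing_isometry (f : V -> V) a v :
    (forall x y, '[f x, f y] = '[x, y]) -> pairing (f a) (f v) = pairing a v.
Proof. by move=> fI; rewrite /pairing !fI. Qed.

Lemma pairing_refl_root a v : a != 0 -> pairing a (refl a v) = - pairing a v.
Proof.
move/dot_neq0=> nz_a; apply: (mulIf nz_a); rewrite mulNr !pairingE reflE !dotE.
have := pairingE a v; lra.
Qed.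

Lemma reflK a v : a != 0 -> refl a (refl a v) = v.
Proof.
by move=> nz_a; rewrite [LHS]reflE pairing_refl_root // scaleNr opprK subrK.
Qed.

Lemma refl_self a : a != 0 -> refl a a = - a.
Proof.
move/dot_neq0=> nz_a; rewrite reflE /pairing mulfK // scaler_nat mulr2n.
by rewrite opprD addNKr.
Qed.

Lemma pairingZ k a v : k != 0 -> pairing (k *: a) v = k^-1 * pairing a v.
Proof.
move=> nz_k; have [-> | /dot_neq0 nz_a] := eqVneq a 0.
  by rewrite scaler0 /pairing !dot0l !(mulr0, mul0r).
by rewrite /pairing !dotE; field; rewrite nz_a nz_k.
Qed.

Lemma reflZ k a : k != 0 -> refl (k *: a) =1 refl a.
Proof.
by move=> nz_k v; rewrite !reflE pairingZ // scalerA mulrAC mulVf // mul1r.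
Qed.

Lemma reflN a : refl (- a) =1 refl a.
Proof. by rewrite -scaleN1r; apply: reflZ; rewrite oppr_eq0 oner_eq0. Qed.

Lemma refl_inj a b : a != 0 -> b != 0 -> refl a =1 refl b ->
  exists k, b = k *: a.
Proof.
move=> nz_a nz_b ab; exists (pairing a b / 2).
have /eqP := ab b; rewrite refl_self // reflE subr_eq addrC -subr_eq opprK.
rewrite -mulr2n -scaler_nat => /eqP/(congr1 ( *:%R 2^-1)).
by rewrite scalerA mulVf ?pnatr_eq0 // scale1r scalerA mulrC => <-.
Qed.

(** [a - b] is normal to the hyperplane equidistant from [a] and [b]. *)
Lemma refl_swap a b : a != b -> '[a, a] = '[b, b] -> refl (a - b) a = b.
Proof.
rewrite -subr_eq0 => /dot_neq0 nz_ab eq_ab.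
suff -> : refl (a - b) a = a - (a - b) by rewrite subKr.
rewrite reflE; suff -> : pairing (a - b) a = 1 by rewrite scale1r.
apply: (mulIf nz_ab); rewrite pairingE mul1r !dotE (dotC b a); lra.
Qed.

Lemma refl_conj (f : {linear V -> V}) a v :
    (forall x y, '[f x, f y] = '[x, y]) ->
  f (refl a v) = refl (f a) (f v).
Proof. by move=> fI; rewrite !reflE linearB linearZ pairing_isometry. Qed.

Lemma coroot_scale_neq0 a : a != 0 -> 2 / '[a, a] != 0.
Proof. by move/dot_neq0=> nz_a; rewrite mulf_neq0 ?pnatr_eq0 ?invr_eq0. Qed.

Lemma pairing_coroot a b : pairing (coroot a) (coroot b) = pairing b a.
Proof.
have [-> | nz_a] := eqVneq a 0.
  by rewrite /coroot scaler0 /pairing !dotE !(mulr0, mul0r).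
rewrite /coroot pairingZ ?coroot_scale_neq0 // /pairing dotZr (dotC b a).
rewrite invf_div.
have := dot_neq0 nz_a => nz_aa; set x := '[b, b]^-1.
by field.
Qed.

Lemma refl_coroot a : a != 0 -> refl (coroot a) =1 refl a.
Proof. by move/coroot_scale_neq0=> nz; exact: reflZ. Qed.

Lemma coroot_refl a b : coroot (refl a b) = refl a (coroot b).
Proof.
rewrite /coroot refl_isometry !reflE /pairing dotZr scalerBr !scalerA.
by congr (_ - _ *: a); rewrite !mulrA; congr (_ / _); ring.
Qed.

Lemma corootK a : a != 0 -> coroot (coroot a) = a.
Proof.
move/dot_neq0=> nz_a; rewrite /coroot !dotE scalerA -[RHS]scale1r.
congr (_ *: _).
by field.
Qed.

Lemma dot_corootP a v : a != 0 -> (0 < '[coroot a, v]) = (0 < '[a, v]).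
Proof. by move/dot_gt0=> a_gt0; rewrite dotZl pmulr_rgt0 // divr_gt0. Qed.

End Reflections.

(** * Two facts on integers *)

Lemma int_gt1 (R : archiRealDomainType) (x : R) :
  x \is a Num.int -> 1 <= x -> x <> 1 -> 2 <= x.
Proof.
case/intrP=> m ->; rewrite ler1z => m1 /eqP; rewrite -[1]/1%:~R eqr_int => mN1.
rewrite -[2]/(2%:~R) ler_int; lia.
Qed.

Lemma mutual_int_multiples (R : realFieldType) (m k : int) (x y : R) : x != 0 ->
  y = m%:~R * x -> x = k%:~R * y -> y = x \/ y = - x.
Proof.
move=> nz_x yE xE; have : (k * m == 1)%R.
  by rewrite -(eqr_int R) intrM -(inj_eq (mulIf nz_x)) mul1r -mulrA -yE -xE.
move=> /eqP/intUnitRing.unitzPl/orP[] /eqP m1.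
  by left; rewrite yE m1 mul1r.
by right; rewrite yE m1 mulN1r.
Qed.

(** * Root systems and their duals *)

Section IntegralRoots.
Variables (R : realType) (V : vectType R) (form : {dot V for idfun}).
Implicit Types (a b c d u v : V) (Phi : seq V).
Local Notation "''[' u , v ]" := (form u v) : ring_scope.
Local Notation refl := (reflection form).
Local Notation pairing := (pairing form).
Local Notation coroot := (coroot form).
Local Notation dotE := (dotE form).

(** The axioms of a crystallographic root system without the spanning
condition, and with reducedness in a form that passes directly to the dual. *)
Record integral_roots Phi : Prop := IntegralRoots {
  root_neq0 : {in Phi, forall a, a != 0};
  root_refl : {in Phi &, forall a b, refl a b \in Phi};
  root_reduced : {in Phi &, forall a b k, b = k *: a -> b = a \/ b = - a};
  root_int : {in Phi &, forall a b, pairing a b \is a Num.int} }.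

Lemma crystallographic_integral Phi :
  crystallographic_root_system form Phi -> integral_roots Phi.
Proof.
case=> Phi0 _ PhiS PhiL PhiZ; split=> // [a aP | a b aP bP | a b aP bP k b_ka].
- by apply: contraNneq Phi0 => <-.
- by rewrite -(PhiS a aP) map_f.
have := PhiL a aP b; rewrite !inE bP b_ka memvZ ?memv_line //= -b_ka.
by case/esym/orP=> /eqP; [left | right].
Qed.

(** Roots and coroots define the same reflections; all statements about coroots
come from applying to the dual system what holds for roots. *)
Lemma dual_roots Phi : integral_roots Phi -> integral_roots (map coroot Phi).
Proof.
move=> rPhi; have nz := root_neq0 rPhi.
split=> [_ /mapP[a aP ->] | _ _ /mapP[a aP ->] /mapP[b bP ->]
        | _ _ /mapP[a aP ->] /mapP[b bP ->] k /(canRL (scalerK _)) ba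
        | _ _ /mapP[a aP ->] /mapP[b bP ->]].
- by rewrite scaler_eq0 (negPf (coroot_scale_neq0 form (nz a aP))) nz.
- by rewrite refl_coroot ?nz // -coroot_refl map_f // (root_refl rPhi).
- move: ba; rewrite {2}/coroot scalerA scalerA.
  move=> /(_ (coroot_scale_neq0 form (nz b bP)))/(root_reduced rPhi aP bP)[] ->.
    by left.
  by right; rewrite /coroot dotNl dotNr opprK scalerN.
by rewrite pairing_coroot (root_int rPhi).
Qed.

Lemma root_opp Phi : integral_roots Phi -> {in Phi, forall a, - a \in Phi}.
Proof.
move=> rPhi a aP; rewrite -(refl_self form (root_neq0 rPhi aP)).
exact: (root_refl rPhi).
Qed.

Lemma cauchy_strict a b : a != 0 -> (forall k, b <> k *: a) ->
  '[a, b] * '[a, b] < '[a, a] * '[b, b].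
Proof.
move=> nz_a nprop; set k := '[a, b] / '[a, a].
have nz_c : b - k *: a != 0 by rewrite subr_eq0; apply/eqP/nprop.
have aa := dot_gt0 form nz_a.
have kE : k * '[a, a] = '[a, b] by rewrite divfK // lt0r_neq0.
have := dot_gt0 form nz_c; rewrite !dotE (dotC form b a) -kE.
move=> cc; have : 0 < '[a, a] * ('[b, b] - k * k * '[a, a]).
  by rewrite mulr_gt0 //; lra.
by lra.
Qed.

Section Roots.
Variable Phi : seq V.
Hypothesis rPhi : integral_roots Phi.

(** The product is four times the squared cosine of the angle. *)
Lemma pairing_mul_lt4 a b : a \in Phi -> b \in Phi -> b <> a -> b <> - a ->
  pairing a b * pairing b a < 4.
Proof.
move=> aP bP ba bNa; have [nz_a nz_b] := (root_neq0 rPhi aP, root_neq0 rPhi bP).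
have [aa bb] := (dot_gt0 form nz_a, dot_gt0 form nz_b).
have /(cauchy_strict nz_a) CS k : b <> k *: a.
  by case/(root_reduced rPhi aP bP).
rewrite -(ltr_pM2r (mulr_gt0 aa bb)).
have -> : pairing a b * pairing b a * ('[a, a] * '[b, b]) =
          (pairing a b * '[a, a]) * (pairing b a * '[b, b]) by ring.
by rewrite !pairingE (dotC form b a); lra.
Qed.

Lemma pairing_ge1 a b : a \in Phi -> b \in Phi -> 0 < '[a, b] ->
  1 <= pairing a b.
Proof.
move=> aP bP ab; have aa := dot_gt0 form (root_neq0 rPhi aP).
have p_gt0 : 0 < pairing a b by rewrite divr_gt0 ?mulr_gt0.
have := norm_intr_ge1 (root_int rPhi aP bP).
by rewrite gtr0_norm // => -> //; rewrite lt0r_neq0.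
Qed.

Lemma pairing_eq1 a b : a \in Phi -> b \in Phi -> 0 < '[a, b] -> b <> a ->
  pairing a b = 1 \/ pairing b a = 1.
Proof.
move=> aP bP ab ba.
have bNa : b <> - a.
  move=> bE; move: ab; rewrite bE dotNr oppr_gt0 ltNge.
  by rewrite ltW ?dot_gt0 // (root_neq0 rPhi aP).
have pab := pairing_ge1 aP bP ab.
have pba : 1 <= pairing b a by apply: pairing_ge1; rewrite // dotC.
have lt4 := pairing_mul_lt4 aP bP ba bNa.
have [/eqP | /eqP/(int_gt1 (root_int rPhi aP bP) pab) ab2] :=
  boolP (pairing a b == 1); first by left.
have [/eqP | /eqP/(int_gt1 (root_int rPhi bP aP) pba) ba2] :=
  boolP (pairing b a == 1); first by right.
by nra.
Qed.

(** Equivalently, [c] is at most as long as every root not orthogonal to it.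
Only roots at an acute angle need testing, since roots come in pairs b, -b. *)
Definition minuscule c :=
  all (fun b => [&& 0 < '[b, c] & b != c] ==> (pairing b c == 1)) Phi.

Lemma minusculeP c : reflect
  {in Phi, forall b, 0 < '[b, c] -> b != c -> pairing b c = 1} (minuscule c).
Proof.
apply: (iffP allP) => min_c b bP.
  by move=> bc b_c; have := min_c b bP; rewrite bc b_c => /eqP.
by apply/implyP=> /andP[bc b_c]; apply/eqP/min_c.
Qed.

Lemma minuscule_refl a c : a \in Phi -> minuscule c -> minuscule (refl a c).
Proof.
move=> aP /minusculeP min_c; apply/minusculeP=> b bP bc b_c.
have rK := reflK form _ (root_neq0 rPhi aP); have rI := refl_isometry form a.
rewrite -(rK b) pairing_isometry //; apply: min_c => //.
- exact: root_refl.
- by rewrite -rI rK.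
by apply: contra_neq b_c => <-; rewrite rK.
Qed.

(** The two pairings of [b] and [c] are integers with product less than 4, so
one of them is 1; if it is not the one of [minuscule], the squared lengths
differ by a factor of at least 2. *)
Lemma not_minuscule c : c \in Phi -> ~~ minuscule c ->
  exists b, [/\ b \in Phi, 0 < '[b, c] & 2 * '[b, b] <= '[c, c]].
Proof.
move=> cP /allPn[b bP]; rewrite negb_imply => /andP[/andP[bc /eqP b_c] /eqP p1].
exists b; split=> //.
have [// | pcb] := pairing_eq1 bP cP bc (nesym b_c).
have p2 := int_gt1 (root_int rPhi bP cP) (pairing_ge1 bP cP bc) p1.
have := pairingE form c b.
rewrite pcb mul1r (dotC form c b) -(pairingE form b c) => ->.
by rewrite ler_pM2r // dot_gt0 // (root_neq0 rPhi bP).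
Qed.

(** Induction on the number of summands in an expression of [c] by elements of
[X]: some summand [x] has positive scalar product with [c], and if [x] is not
[c] then the reflection in [x] maps [c] to [c - x], a shorter sum which is again
a minuscule root. *)
Lemma zspan_minuscule (X : V -> Prop) c :
    (forall x, X x -> x \in Phi) -> (forall x y, X x -> X y -> X (refl x y)) ->
  c \in Phi -> minuscule c -> zspan X c -> X c.
Proof.
move=> XPhi Xrefl cP min_c Xc.
have XN x : X x -> X (- x).
  move=> Xx; rewrite -(refl_self form (root_neq0 rPhi (XPhi x Xx))).
  exact: Xrefl.
have [s Xs cE] := zspan_sum XN Xc; clear Xc.
have [n ns] := ubnP (size s).
elim: n s c ns cP min_c Xs cE => // n IH s c ns cP min_c Xs cE.
have cc := dot_gt0 form (root_neq0 rPhi cP).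
have [x xs xc] : exists2 x, x \in s & 0 < '[x, c].
  apply/hasP; apply: contraLR cc => /hasPn xc_le0.
  rewrite {1}cE linear_sumlz big_seq -leNgt; apply: sumr_le0 => x /xc_le0.
  by rewrite -leNgt.
have [-> | x_c] := eqVneq c x; first exact: Xs.
have xP := XPhi x (Xs x xs).
have pxc : pairing x c = 1 by apply: (minusculeP _ min_c); rewrite // eq_sym.
have cxE : refl x c = c - x by rewrite reflE pxc scale1r.
rewrite -(reflK form c (root_neq0 rPhi xP)); apply: Xrefl; first exact: Xs.
apply: (IH (rem x s)); rewrite ?(root_refl rPhi) ?minuscule_refl //.
- by rewrite size_rem // prednK //; case: (s) xs.
- by move=> y /mem_rem; exact: Xs.
by rewrite cxE cE (perm_big _ (perm_to_rem xs)) big_cons addrC addKr.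
Qed.

(** The pairings [p], [q] of [b] and [d] are nonzero integers with p q < 4 and
p (b|b) = q (d|d); multiply by [q]. *)
Lemma root_ratio_lt4 b d : b \in Phi -> d \in Phi -> '[b, d] != 0 ->
  '[d, d] < 4 * '[b, b].
Proof.
move=> bP dP bd; have bb := dot_gt0 form (root_neq0 rPhi bP).
have dd := dot_gt0 form (root_neq0 rPhi dP).
have [-> | /eqP db] := eqVneq d b; first by lra.
have [-> | /eqP dNb] := eqVneq d (- b); first by rewrite !dotE; lra.
have lt4 := pairing_mul_lt4 bP dP db dNb.
have q_neq0 : pairing d b != 0.
  rewrite /pairing mulf_neq0 ?mulf_neq0 ?invr_eq0 ?pnatr_eq0 //.
  by rewrite dotC. by rewrite lt0r_neq0.
have q2 := sqr_intr_ge1 (root_int rPhi dP bP) q_neq0.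
have E : pairing b d * '[b, b] = pairing d b * '[d, d].
  by rewrite !pairingE (dotC form b d).
rewrite -(ltr_pM2l bb) in lt4.
have : '[d, d] <= pairing d b ^+ 2 * '[d, d] by rewrite ler_peMl // ltW.
by move: (congr1 ( *%R (pairing d b)) E); lra.
Qed.

End Roots.

(** Otherwise there are roots [b], [d], both nonorthogonal to [c], with
2 (b|b) <= (c|c) and 2 (c|c) <= (d|d). Reflecting [d] in [c] if necessary, [b]
and [d] are not orthogonal, against [root_ratio_lt4]. *)
Lemma minuscule_dichotomy Phi c : integral_roots Phi -> c \in Phi ->
  minuscule Phi c \/ minuscule (map coroot Phi) (coroot c).
Proof.
move=> rPhi cP; have [|] := boolP (minuscule Phi c); first by left.
move=> /(not_minuscule rPhi cP)[b [bP bc bb]].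
have cP' : coroot c \in map coroot Phi by exact: map_f.
have [|] := boolP (minuscule (map coroot Phi) (coroot c)); first by right.
move=> /(not_minuscule (dual_roots rPhi) cP')[_ [/mapP[d dP ->] cd dd']].
have c0 := dot_gt0 form (root_neq0 rPhi cP).
have d0 := dot_gt0 form (root_neq0 rPhi dP).
have dc : 0 < '[d, c].
  move: cd; rewrite dot_corootP ?(root_neq0 rPhi dP) //.
  by rewrite dotC dot_corootP ?(root_neq0 rPhi cP) // dotC.
have dd : 2 * '[c, c] <= '[d, d].
  have coE x : 0 < '[x, x] -> '[coroot x, coroot x] = 4 / '[x, x].
    by move/lt0r_neq0=> nz; rewrite !dotE; field.
  move: dd'; rewrite !coE // mulrA ler_pdivrMr // mulrAC ler_pdivlMr //; lra.
have lt4 := root_ratio_lt4 rPhi bP.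
(* If b and d are orthogonal, then b and the reflection of d in c are not. *)
have [bd | bd] := eqVneq '[b, d] 0; last by have := lt4 d dP bd; lra.
have := lt4 _ (root_refl rPhi cP dP).
rewrite refl_isometry reflE !dotE bd sub0r oppr_eq0 => /(_ _) H.
suff /H : pairing c d * '[b, c] != 0 by lra.
by rewrite mulf_neq0 ?lt0r_neq0 // divr_gt0 // mulr_gt0 // dotC.
Qed.

(** By [minuscule_dichotomy], [zspan_minuscule] applies to [c] or to its coroot.
The root lattice alone does not determine a subsystem: the short roots of B2
span its root lattice without including its long roots. *)
Lemma zspan_roots Phi (X : V -> Prop) c : integral_roots Phi ->
    (forall x, X x -> x \in Phi) -> (forall x y, X x -> X y -> X (refl x y)) ->
    c \in Phi -> zspan X c -> zspan (fun y => X (coroot y)) (coroot c) -> X c.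
Proof.
move=> rPhi XPhi Xrefl cP Xc X'c.
have [min_c | min_c] := minuscule_dichotomy rPhi cP.
  exact: zspan_minuscule min_c Xc.
have nz x : x \in Phi -> x != 0 by exact: (root_neq0 rPhi).
rewrite -(corootK form (nz c cP)).
have nzX x : X (coroot x) -> x != 0.
  by move=> /XPhi/nz; apply: contra_neq => ->; rewrite /coroot scaler0.
apply: (zspan_minuscule (dual_roots rPhi) (X := fun y => X (coroot y)))
  min_c X'c.
- by move=> x Xx; rewrite -(corootK form (nzX x Xx)) map_f ?XPhi.
- move=> x y Xx Xy; rewrite coroot_refl -refl_coroot ?nzX //; exact: Xrefl.
exact: map_f.
Qed.
End IntegralRoots.

(** * Reflections in a generating set *)

Section ReflectionConjugacy.
Local Open Scope group_scope.
Variables (gT : finGroupType).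
Implicit Types (W : {group gT}) (S T X : {set gT}).

(** In a dihedral group, [y] inverts the rotation u = y z, so that
y ^ (u ^ k) = y u ^ (2 k); an odd order of [u] makes 2 k = 1 solvable. *)
Lemma odd_dihedral_conj (y z : gT) :
  y * y = 1 -> z * z = 1 -> odd #[y * z] ->
  z = y ^ ((y * z) ^+ (#[y * z]./2).+1).
Proof.
move=> yy zz odd_yz; set u := y * z; set m := (_./2).+1.
have yV : y^-1 = y by apply/eqP; rewrite eq_invg_mul yy.
have zV : z^-1 = z by apply/eqP; rewrite eq_invg_mul zz.
have uyV : u ^ y = u^-1 by rewrite conjgE yV /u invMg yV zV !mulgA yy mul1g.
have E : (u ^+ m)^-1 * y = y * u ^+ m.
  by rewrite -expgVn -uyV -conjXg conjgE yV -!mulgA yy mulg1.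
rewrite conjgE mulgA E -mulgA -expgD.
have -> : (m + m = #[u] + 1)%N.
  by rewrite /m addnn doubleS -[in RHS](odd_double_half #[u]) odd_yz; lia.
by rewrite expgD expg_order mul1g expg1 /u mulgA yy mul1g.
Qed.

(** Sending the simple reflections conjugate to [s] to the transposition and the
others to 1 respects the Coxeter relations, as two simple reflections whose
product has odd order are conjugate. If no member of [X] were conjugate to [s],
then the resulting character would be trivial on [X], hence on W, but it is not
trivial at [s]. *)
Lemma reflection_gens_conj W T n S X s : simple_system W T n S ->
    X \subset T -> <<X>> = W -> s \in S ->
  exists2 x, x \in X & x \in s ^: W.
Proof.
case=> _ _ [defW ord2 univ] defT sXT genX sS; apply/exists_inP.
apply: contraT; rewrite negb_exists_in => /forall_inP/= not_conj.
have sSW : S \subset W by rewrite -defW subset_gen.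
have inv2 y : y \in S -> y * y = 1
  by move/ord2=> o2; rewrite -expg2 -o2 expg_order.
pose z := tperm true false; have zz : z * z = 1 by rewrite tperm2.
pose f y : {perm bool} := if y \in s ^: W then z else 1.
have [|phi [phiM phiS]] := univ _ f.
  have classE x y : x \in S -> y \in S -> odd #[x * y] ->
      (x \in s ^: W) = (y \in s ^: W).
    move=> xS yS /(odd_dihedral_conj (inv2 x xS) (inv2 y yS)) yE.
    rewrite [in RHS]yE class_sym [RHS]class_sym classGidl //.
    by rewrite groupX // groupM ?(subsetP sSW).
  move=> x y xS yS; rewrite /f.
  have zn k : ~~ odd k -> z ^+ k = 1.
    move=> ev; rewrite -(odd_double_half k) (negPf ev) add0n -mul2n expgM.
    by rewrite expg2 zz expg1n.
  have := classE x y xS yS; case: (x \in _) (y \in _) => [] [] xy;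
    rewrite ?zz ?mulg1 ?mul1g ?expg1n //; apply/zn/negP=> /xy; done.
pose phim := Morphism phiM.
have sXker : X \subset 'ker phim.
  apply/subsetP=> x xX; have := subsetP sXT x xX; rewrite defT.
  case/imset2P=> y w yS wW xE; have yW := subsetP sSW y yS.
  have phiy : phim y = 1.
    rewrite /= phiS // /f ifN //; apply: contra (not_conj x xX).
    by case/imsetP=> g gW yE; rewrite xE yE -conjgM memJ_class ?groupM.
  by rewrite xE memJ_norm ?(subsetP (ker_norm _)) //; apply/kerP.
have : s \in 'ker phim.
  have sW : s \in <<X>> by rewrite genX (subsetP sSW).
  by apply: subsetP sW; rewrite gen_subG.
case/morphpreP=> _ /set1P/=; rewrite phiS // /f class_refl.
move/(congr1 (fun p : {perm bool} => p true)).
by rewrite tpermL perm1.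
Qed.
End ReflectionConjugacy.

(** * Roots of reflections in an orthogonal representation *)

Section ReflectionRepresentation.
Variables (R : realType) (V : vectType R) (form : {dot V for idfun}).
Variables (Phi : seq V) (gT : finGroupType) (W : {group gT}).
Variable rho : gT -> 'End(V).
Hypothesis rPhi : integral_roots form Phi.
Hypothesis rhoM : {in W &, forall x y, rho (x * y)%g = (rho x \o rho y)%VF}.
Hypothesis rho_isom : {in W, forall x u v, form (rho x u) (rho x v) = form u v}.
Implicit Types (a b u v : V) (x y t w : gT).
Local Notation "''[' u , v ]" := (form u v) : ring_scope.
Local Notation refl := (reflection form).

Definition root_of t a := a \in Phi /\ rho t =1 refl a.

Lemma rhoMv x y v : x \in W -> y \in W -> rho (x * y)%g v = rho x (rho y v).
Proof. by move=> xW yW; rewrite rhoM // comp_lfunE. Qed.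

Lemma rho_inj0 x v : x \in W -> rho x v = 0 -> v = 0.
Proof.
move=> xW xv0; apply/eqP; apply: contraTT isT => /(dot_gt0 form).
by rewrite -(rho_isom xW) xv0 !dot0l ltxx.
Qed.

Lemma rho1 v : rho 1%g v = v.
Proof.
apply/eqP; rewrite -subr_eq0; apply/eqP/(rho_inj0 (group1 W)).
by rewrite linearB /= -rhoMv // mulg1 subrr.
Qed.

Lemma rhoKV w v : w \in W -> rho w (rho w^-1%g v) = v.
Proof. by move=> wW; rewrite -rhoMv ?groupV // mulgV rho1. Qed.

Lemma rho_gen_closed (X : {set gT}) (Q : V -> Prop) : X \subset W ->
    (forall x v, x \in X -> Q v -> Q (rho x v)) ->
  forall w v, w \in <<X>>%g -> Q v -> Q (rho w v).
Proof.
move=> sXW QX w v /gen_prodgP[n [c cX ->]] Qv.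
elim: n c cX => [|n IH] c cX; first by rewrite big_ord0 rho1.
have cW i : c i \in W by rewrite (subsetP sXW).
rewrite big_ord_recl rhoMv ?group_prod //.
by apply: QX (cX _) _; apply: IH => i; exact: cX.
Qed.

Lemma root_of_conj t a w : t \in W -> w \in W -> rho w a \in Phi ->
  root_of t a -> root_of (t ^ w^-1)%g (rho w a).
Proof.
move=> tW wW waP [_ ta]; split=> // v.
rewrite conjgE invgK !rhoMv ?groupM ?groupV // ta.
by rewrite (refl_conj a _ (rho_isom wW)) /= rhoKV.
Qed.

Lemma root_of_unique t a b : root_of t a -> root_of t b -> b = a \/ b = - a.
Proof.
move=> [aP ta] [bP tb].
have [||v|k] := @refl_inj _ _ form a b; rewrite -?ta -?tb ?(root_neq0 rPhi) //.
exact: (root_reduced rPhi).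
Qed.

Definition root_set (r : gT -> V) (X : {set gT}) v :=
  exists2 x, x \in X & v = r x.

Section Generators.
Variables (r : gT -> V) (X : {set gT}).
Hypothesis genX : <<X>>%g = W.
Hypothesis rX : {in X, forall x, root_of x (r x)}.

Lemma gens_sub : X \subset W. Proof. by rewrite -genX subset_gen. Qed.

Lemma rho_root w a : w \in W -> a \in Phi -> rho w a \in Phi.
Proof.
rewrite -genX => wX.
apply: (rho_gen_closed (Q := fun v => v \in Phi) gens_sub) wX.
by move=> x v /rX[rxP ->] vP; exact: (root_refl rPhi).
Qed.

(** Reflecting a root in a generating root subtracts an integral multiple of the
latter, so W permutes the roots in the integral span of the generating ones. *)
Lemma conj_root_zspan x t b : x \in X -> t \in (x ^: W)%g -> root_of t b ->
  zspan (root_set r X) b.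
Proof.
move=> xX /imsetP[w wW tE] tb; have [rxP _] := rX xX.
have xW := subsetP gens_sub x xX.
have wVX : w^-1%g \in <<X>>%g by rewrite genX groupV.
have [_] : rho w^-1%g (r x) \in Phi /\ zspan (root_set r X) (rho w^-1%g (r x)).
  apply: (rho_gen_closed (Q := fun v => v \in Phi /\ zspan _ v) gens_sub) wVX _.
    move=> y v yX [vP Xv]; have [ryP ry] := rX yX.
    rewrite ry; split; first exact: (root_refl rPhi).
    have /intrP[m mE] := root_int rPhi ryP vP.
    rewrite reflE mE scaler_int; apply/(zspanB Xv)/zspanMz/zspan_gen.
    by exists y.
  by split=> //; apply: zspan_gen; exists x.
have := root_of_conj xW (groupVr wW) (rho_root (groupVr wW) rxP) (rX xX).
rewrite invgK -tE => /root_of_unique/(_ tb)[] -> //; exact: zspanN.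
Qed.

End Generators.

(** * Averages over a subgroup *)

Section Average.
Variable G : {group gT}.
Hypothesis sGW : G \subset W.

(** Not divided by [#|G|], as only its direction matters. *)
Definition average v := \sum_(w in G) rho w v.

Lemma average_rho w v : w \in G -> average (rho w v) = average v.
Proof.
move=> wG; rewrite /average [RHS](reindex_inj (mulIg w)) /=.
apply: eq_big => [x | x xG]; first by rewrite groupMr.
by rewrite rhoMv ?(subsetP sGW).
Qed.

Lemma averageB u v : average (u - v) = average u - average v.
Proof. by rewrite -sumrB; apply: eq_bigr => w _; rewrite linearB. Qed.

(** [t] changes the sign of [a] but preserves its average. *)
Lemma average_root t a : t \in G -> root_of t a -> average a = 0.
Proof.
move=> tG [aP ta]; have : average a + average a = 0.
  rewrite -{1}(average_rho _ tG) ta (refl_self form (root_neq0 rPhi aP)).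
  rewrite -sub0r averageB {1}/average big1 ?sub0r ?addNr // => w _.
  by rewrite linear0.
move/eqP; rewrite -mulr2n -scaler_nat scaler_eq0 pnatr_eq0 /=; exact/eqP.
Qed.

Lemma dot_average u v w : w \in G -> '[average u, rho w v] = '[average u, v].
Proof.
move=> wG; have wW := subsetP sGW w wG.
rewrite /average !linear_sumlz.
rewrite (reindex_inj (mulgI w)) /=; apply: eq_big => [x | x].
  by rewrite groupMl.
rewrite groupMl // => xG; have xW := subsetP sGW x xG.
by rewrite rhoMv // rho_isom.
Qed.

Lemma dot_average2 u v : '[average u, average v] = #|G|%:R * '[average u, v].
Proof.
rewrite {2}/average linear_sumr (eq_bigr (fun=> '[average u, v])).
  by rewrite sumr_const mulr_natl.
by move=> w wG; exact: dot_average.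
Qed.

End Average.

End ReflectionRepresentation.

(** * Levels with respect to a maximal parabolic subgroup *)

Section MaximalParabolic.
Variables (R : realType) (V : vectType R) (form : {dot V for idfun}).
Variables (Phi : seq V) (gT : finGroupType) (W : {group gT}).
Variable rho : gT -> 'End(V).
Hypothesis rPhi : integral_roots form Phi.
Hypothesis rhoM : {in W &, forall x y, rho (x * y)%g = (rho x \o rho y)%VF}.
Hypothesis rho_isom : {in W, forall x u v, form (rho x u) (rho x v) = form u v}.
Implicit Types (a b u v : V) (t w : gT).
Local Notation "''[' u , v ]" := (form u v) : ring_scope.
Local Notation refl := (reflection form).
Local Notation coroot := (coroot form).
Local Notation has_root := (root_of form Phi rho).

Lemma root_of_coroot t a : has_root t a ->
  root_of form (map coroot Phi) rho t (coroot a).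
Proof.
case=> aP ta; split; first exact: map_f.
by move=> v; rewrite ta refl_coroot ?(root_neq0 rPhi).
Qed.

Lemma conj_coroot_zspan r (X : {set gT}) x t b : <<X>>%g = W ->
    {in X, forall x, has_root x (r x)} ->
    x \in X -> t \in (x ^: W)%g -> has_root t b ->
  zspan (root_set (coroot \o r) X) (coroot b).
Proof.
move=> genX rX xX tx tb.
apply: (conj_root_zspan (dual_roots rPhi) rhoM rho_isom genX) xX tx _.
  by move=> y /rX/root_of_coroot.
exact: root_of_coroot.
Qed.

Lemma zspan_orth (Y : V -> Prop) q v : (forall y, Y y -> '[q, y] = 0) ->
  zspan Y v -> '[q, v] = 0.
Proof.
move=> Y0; elim=> [y /Y0 // | | u w _ qu _ qw]; first exact: dot0r.
by rewrite dotDr dotNr qu qw subr0.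
Qed.

Lemma dotMz q a (m : int) : '[q, a *~ m] = m%:~R * '[q, a].
Proof. by rewrite -scaler_int dotZr. Qed.

Lemma zspan_level (X Y : V -> Prop) a q v :
    (forall x, X x -> x = a \/ Y x) -> (forall y, Y y -> '[q, y] = 0) ->
    zspan X v ->
  exists2 m : int, '[q, v] = m%:~R * '[q, a] & zspan Y (v - a *~ m).
Proof.
move=> XaY Y0 /(zspan_coef XaY)[m Ym]; exists m => //.
apply/eqP; rewrite -dotMz -subr_eq0 -dotNr -dotDr; apply/eqP.
exact: zspan_orth Ym.
Qed.

Lemma root_setU1 (f : gT -> V) (J : {set gT}) t v :
  root_set f (t |: J) v -> v = f t \/ root_set f J v.
Proof. by case=> y /setU1P[-> | yJ] ->; [left | right; exists y]. Qed.

Variables (T J : {set gT}) (s : gT) (n : nat) (r : gT -> V).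
Hypothesis simpleS : simple_system W T n (s |: J).
Hypothesis rT : {in T, forall t, has_root t (r t)}.
Hypothesis Phi_refl : {in Phi, forall a, exists2 t, t \in T & has_root t a}.
Hypothesis indep : r s \notin <<[seq r j | j <- enum J]>>%VS.

Let P := <<J>>%G.
(** Up to a positive scalar, the orthogonal projection of the root of [s] to the
fixed space of [P]. *)
Let q := average rho P (r s).

Let genS : <<s |: J>>%g = W. Proof. by case: simpleS => _ _ []. Qed.
Let sST : s |: J \subset T. Proof. by case: simpleS. Qed.
Let rS : {in s |: J, forall x, has_root x (r x)}.
Proof. by move=> x /(subsetP sST)/rT. Qed.
Let sPW : P \subset W.
Proof.
by rewrite gen_subG -genS (subset_trans (subsetUr [set s] J)) ?subset_gen.
Qed.
Let JP j : j \in J -> j \in P. Proof. exact: mem_gen. Qed.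
Let JS j : j \in J -> j \in s |: J. Proof. exact: setU1r. Qed.
Let cardP_neq0 : #|P|%:R != 0 :> R.
Proof. by rewrite pnatr_eq0 -lt0n cardG_gt0. Qed.

Let level_J y : root_set r J y -> '[q, y] = 0.
Proof.
case=> j jJ ->; apply/eqP; rewrite -(mulrI_eq0 _ (lregP cardP_neq0)).
rewrite -(dot_average2 rhoM rho_isom sPW).
by rewrite (average_root rPhi rhoM sPW (JP jJ) (rS (JS jJ))) dot0r.
Qed.

Let level_coJ y : root_set (coroot \o r) J y -> '[q, y] = 0.
Proof. by case=> j jJ -> /=; rewrite dotZr level_J ?mulr0 //; exists j. Qed.

(** Modulo the span of the roots of J, the average of the root of [s] is
[#|P|] times that root. *)
Lemma level_s_gt0 : 0 < '[q, r s].
Proof.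
have q_neq0 : q != 0.
  apply: contraNneq indep => q0; set U := <<_>>%VS.
  have rP w : w \in P -> rho w (r s) - r s \in U.
    move=> wP; apply: (rho_gen_closed rhoM rho_isom (X := J)
      (Q := fun v => v - r s \in U)) wP _; last by rewrite subrr mem0v.
      by apply: subset_trans sPW; exact: subset_gen.
    move=> j v jJ vU; rewrite (proj2 (rS (JS jJ))) reflE addrAC memvB //.
    by rewrite memvZ // memv_span // map_f // mem_enum.
  have: \sum_(w in P) (rho w (r s) - r s) \in U by exact: memv_suml.
  rewrite sumrB sumr_const -/(average rho P (r s)) -/q q0 sub0r memvN.
  rewrite -scaler_nat => /(memvZ #|P|%:R^-1).
  by rewrite scalerA mulVf // scale1r.
have := dot_gt0 form q_neq0; rewrite (dot_average2 rhoM rho_isom sPW).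
by rewrite pmulr_rgt0 // ltr0n cardG_gt0.
Qed.

Let level_neq0 : '[q, r s] != 0. Proof. by rewrite lt0r_neq0 ?level_s_gt0. Qed.

Lemma root_level b : b \in Phi ->
  exists2 m : int, '[q, b] = m%:~R * '[q, r s]
                 & zspan (root_set r J) (b - r s *~ m).
Proof.
case/Phi_refl=> t; case: simpleS => _ _ _ -> /imset2P[x w xS wW ->] tb.
apply: zspan_level (@root_setU1 r J s) level_J _.
exact: (conj_root_zspan rPhi rhoM rho_isom genS rS xS (memJ_class _ wW) tb).
Qed.

Lemma coroot_level b : b \in Phi ->
  exists2 m : int, '[q, coroot b] = m%:~R * '[q, coroot (r s)]
    & zspan (root_set (coroot \o r) J) (coroot b - coroot (r s) *~ m).
Proof.
case/Phi_refl=> t; case: simpleS => _ _ _ -> /imset2P[x w xS wW ->] tb.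
apply: zspan_level (@root_setU1 (coroot \o r) J s) level_coJ _.
exact: (conj_coroot_zspan genS rS xS (memJ_class _ wW) tb).
Qed.

Let rsP : r s \in Phi. Proof. by have [] := rS (setU11 s J). Qed.

Let coroot_level_scale b : b \in Phi -> '[q, coroot b] * '[b, b] = 2 * '[q, b].
Proof.
move=> /(root_neq0 rPhi)/(dot_neq0 form) nz.
by rewrite dotZr mulrAC divfK.
Qed.

(** Roots of level 0 are combinations of the roots of J, likewise for coroots,
so [zspan_roots] applies with [X] the set of P-conjugates of roots of J. *)
Lemma level0_refl_parabolic b : b \in Phi -> '[q, b] = 0 ->
  exists2 p, p \in P & rho p =1 refl b.
Proof.
move=> bP b0.
pose X v := exists w j, [/\ w \in P, j \in J & v = rho w (r j)].
have rho_P w a : w \in P -> a \in Phi -> rho w a \in Phi.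
  by move/(subsetP sPW); exact: (rho_root rPhi rhoM rho_isom genS rS).
have Xrefl x : X x -> x \in Phi /\ exists2 p, p \in P & rho p =1 refl x.
  case=> w [j [wP jJ ->]]; have rj := rS (JS jJ).
  have rjP := rho_P w _ wP (proj1 rj); split=> //.
  exists (j ^ w^-1)%g; first exact: groupJ (JP jJ) (groupVr wP).
  have [jW wW] := (subsetP sPW j (JP jJ), subsetP sPW w wP).
  by case: (root_of_conj rhoM rho_isom jW wW rjP rj).
have Xr j : j \in J -> X (r j).
  by move=> jJ; exists 1%g, j; rewrite (rho1 rhoM rho_isom) group1.
suff /Xrefl[] : X b by [].
apply: (zspan_roots rPhi) (bP) _ _ => [x /Xrefl[] // | x y | | ].
- move=> /Xrefl[_ [p pP px]] [w [j [wP jJ ->]]].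
  exists (p * w)%g, j; split; rewrite ?groupM //.
  by rewrite -px (rhoMv rhoM) ?(subsetP sPW).
- have [m mE] := root_level bP; move: mE; rewrite b0 => /esym/eqP.
  rewrite mulf_eq0 (negPf level_neq0) orbF intr_eq0 => /eqP->.
  rewrite mulr0z subr0; apply: zspan_sub => _ [j jJ ->].
  by apply: zspan_gen; apply: Xr.
have [m mE] := coroot_level bP; move: mE.
rewrite !dotZr b0 mulr0 => /esym/eqP; rewrite !mulf_eq0 (negPf level_neq0) orbF.
rewrite -mulf_eq0 (negPf (coroot_scale_neq0 form (root_neq0 rPhi rsP))) orbF.
rewrite intr_eq0 => /eqP->.
rewrite mulr0z subr0; apply: zspan_sub => _ [j jJ ->].
apply: zspan_gen; rewrite /= corootK; first exact: Xr.
by rewrite (root_neq0 rPhi) //; case: (rS (JS jJ)).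
Qed.

(** The levels of the two roots are integral multiples of each other, so they
agree up to sign, and so do those of the two coroots. As the coroot of [a] is
2 a / (a|a), this forces equal lengths. *)
Lemma generating_root_level t : t \in T -> <<t |: J>>%g = W ->
  ('[q, r t] = '[q, r s] \/ '[q, r t] = - '[q, r s])
  /\ '[r t, r t] = '[r s, r s].
Proof.
move=> tT genX; have sXT : t |: J \subset T.
  by rewrite subUset sub1set tT (subset_trans (subsetUr [set s] J)).
have [x xX xs] := reflection_gens_conj simpleS sXT genX (setU11 s J).
have rX : {in t |: J, forall x, has_root x (r x)} by move=> y /(subsetP sXT)/rT.
have sx : s \in (x ^: W)%g by rewrite class_sym.
have rs := rS (setU11 s J); have [rtP _] := rT tT.
have [k kE _] := zspan_level (@root_setU1 r J t) level_J
  (conj_root_zspan rPhi rhoM rho_isom genX rX xX sx rs).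
have [k' kE' _] := zspan_level (@root_setU1 (coroot \o r) J t) level_coJ
  (conj_coroot_zspan genX rX xX sx rs).
have [m mE _] := root_level rtP; have [m' mE' _] := coroot_level rtP.
have co_neq0 : '[q, coroot (r s)] != 0.
  by rewrite dotZr mulf_neq0 ?coroot_scale_neq0 ?(root_neq0 rPhi).
have lev := mutual_int_multiples level_neq0 mE kE.
have colev := mutual_int_multiples co_neq0 mE' kE'.
split=> //.
have ss := dot_gt0 form (root_neq0 rPhi rsP).
have tt := dot_gt0 form (root_neq0 rPhi rtP).
have Es := coroot_level_scale rsP; have Et := coroot_level_scale rtP.
have co_gt0 : 0 < '[q, coroot (r s)].
  by rewrite dotZr mulr_gt0 ?divr_gt0 ?level_s_gt0.
have := level_s_gt0; move: lev colev Es Et co_gt0.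
by case=> ->; case=> -> Es Et c0 l0; apply: (mulfI co_neq0); nra.
Qed.

(** [a] and [b] have the same average as the root of [s], because they differ
from it by combinations of roots of J. This average has positive norm, so some
P-conjugates of [a] and [b] have positive scalar product. *)
Lemma level_roots_conj a b : a \in Phi -> b \in Phi ->
    '[q, a] = '[q, r s] -> '[q, b] = '[q, r s] -> '[a, a] = '[b, b] ->
  exists2 w, w \in P & rho w a = b.
Proof.
move=> aP bP qa qb ab.
have rho_P w c : w \in P -> c \in Phi -> rho w c \in Phi.
  by move/(subsetP sPW); exact: (rho_root rPhi rhoM rho_isom genS rS).
have rho_q w c : w \in P -> '[q, rho w c] = '[q, c].
  by move=> wP; exact: (dot_average rhoM rho_isom sPW).
have avgE c : c \in Phi -> '[q, c] = '[q, r s] -> average rho P c = q.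
  move=> cP qc; have [m mE cJ] := root_level cP.
  have m1 : m = 1.
    apply/eqP; rewrite -(eqr_int R) -(inj_eq (mulIf level_neq0)) -mE qc.
    by rewrite mul1r.
  rewrite m1 mulr1z in cJ.
  apply/eqP; rewrite -subr_eq0 -averageB; apply/eqP.
  elim: cJ => [_ [j jJ ->] | | u v _ u0 _ v0].
  - exact: (average_root rPhi rhoM sPW (JP jJ) (rS (JS jJ))).
  - by rewrite -[in LHS](subrr (r s)) averageB subrr.
  by rewrite averageB u0 v0 subrr.
have [x xP [y yP xy]] : exists2 x, x \in P &
    exists2 y, y \in P & 0 < '[rho x a, rho y b].
  have qq : 0 < '[average rho P a, average rho P b].
    rewrite avgE // avgE // (dot_average2 rhoM rho_isom sPW).
    by apply: mulr_gt0 level_s_gt0; rewrite ltr0n cardG_gt0.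
  have /existsP[x /andP[xP]] : [exists x, (x \in P) &&
      [exists y, (y \in P) && (0 < '[rho x a, rho y b])]].
    apply: contraLR qq => /existsPn no_xy; rewrite -leNgt.
    rewrite {1}/average linear_sumlz; apply: sumr_le0 => x xP.
    rewrite /average linear_sumr; apply: sumr_le0 => y yP.
    have := no_xy x; rewrite xP => /existsPn/(_ y).
    by rewrite yP -leNgt.
  by case/existsP=> y /andP[yP xy]; exists x => //; exists y.
have xaP := rho_P x a xP aP; have ybP := rho_P y b yP bP.
have norm_xy : '[rho x a, rho x a] = '[rho y b, rho y b].
  by rewrite !rho_isom ?(subsetP sPW).
have [p pP pE] : exists2 p, p \in P & rho p (rho x a) = rho y b.
  have [<- | /eqP ne] := eqVneq (rho x a) (rho y b).
    by exists 1%g; rewrite ?(rho1 rhoM rho_isom).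
  (* If <x a, (y b)^vee> = 1, then the reflection of x a in y b is x a - y b. *)
  have diffP : rho x a - rho y b \in Phi.
    have [p1 | p1] := pairing_eq1 rPhi xaP ybP xy (nesym ne).
      have := root_refl rPhi xaP ybP; rewrite reflE p1 scale1r.
      by move/(root_opp rPhi); rewrite opprB.
    by have := root_refl rPhi ybP xaP; rewrite reflE p1 scale1r.
  have [|p pP pE] := level0_refl_parabolic diffP.
    by rewrite dotDr dotNr !rho_q // qa qb subrr.
  by exists p; rewrite // pE refl_swap //; exact/eqP.
exists (y^-1 * (p * x))%g; first by rewrite !groupM ?groupV.
have sub := subsetP sPW.
have [xW yW pW] := And3 (sub x xP) (sub y yP) (sub p pP).
rewrite !(rhoMv rhoM) ?groupM ?groupV // pE -(rhoMv rhoM) ?groupV //.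
by rewrite mulVg (rho1 rhoM rho_isom).
Qed.

End MaximalParabolic.

Theorem theorem1p5 (R : realType) (gT : finGroupType) (W : {group gT})
    (T : {set gT}) (n : nat) (P : {group gT}) :
  (0 < n)%N ->
  dual_coxeter_system W T n ->
  crystallographic R W T n ->
  parabolic_subgroup W T n n.-1 P ->
  [transitive P, on [set t in T | <<t |: P>>%g == W] | 'J].
Proof.
move=> n_gt0 _ [V [form [Phi [rho [[dimV crysPhi] [rhoM rho_inj]]]]]].
move=> rho_isom Trho Phirho.
case=> S [J [simpleS sJS cardJ defP]].
have{P defP} -> : P = <<J>>%G by exact: group_inj.
have [s defS] : exists s, S = s |: J.
  have /eqP/cards1P[s sE] : #|S :\: J| = 1%N.
    case: simpleS => _ cardS _ _; rewrite cardsD (setIidPr sJS) cardS cardJ.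
    by rewrite -(prednK n_gt0) subSnn.
  by exists s; rewrite -sE -[LHS](setID _ J) (setIidPr sJS) setUC.
rewrite {}defS in simpleS sJS.
have [sST _ [genS _ _] defT] := simpleS.
have rPhi := crystallographic_integral crysPhi.
have sSW : s |: J \subset W by rewrite -genS subset_gen.
have sTW : T \subset W by rewrite defT class_support_subG.
have /fin_all_exists[r rT] t : exists a, t \in T -> root_of form Phi rho t a.
  have [tT | ] := boolP (t \in T); last by exists 0.
  by have [a] := Trho t tT; exists a.
have rS : {in s |: J, forall x, root_of form Phi rho x (r x)}.
  by move=> x /(subsetP sST)/rT.
have Phi_refl :
    {in Phi, forall a, exists2 t, t \in T & root_of form Phi rho t a}.
  by move=> a aP; have [t tT ta] := Phirho a aP; exists t.
(* The roots of S span V, and J has fewer elements than the dimension of V. *)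
have indep : r s \notin <<[seq r j | j <- enum J]>>%VS.
  set U := <<_>>%VS; apply/negP=> rsU.
  have USpan b : zspan (root_set r (s |: J)) b -> b \in U.
    elim=> [_ [x /setU1P[-> | xJ] ->] // | | u v _ uU _ vU].
    - by rewrite memv_span // map_f // mem_enum.
    - exact: mem0v.
    exact: memvB.
  have fullU : (fullv <= U)%VS.
    case: crysPhi => _ <- _ _ _; apply/span_subvP=> b /Phi_refl[t].
    rewrite defT => /imset2P[x w xS wW ->] tb; apply: USpan.
    exact: (conj_root_zspan rPhi rhoM rho_isom genS rS xS (memJ_class _ wW) tb).
  have := leq_trans (dimvS fullU) (dim_span _).
  by rewrite dimV size_map -cardE cardJ -ltnS prednK // ltnn.
have [sT sW] := (subsetP sST s (setU11 s J), subsetP sSW s (setU11 s J)).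
have sPW : <<J>>%g \subset W by rewrite gen_subG (subset_trans sJS).
have genJ x : <<x |: <<J>>>>%g = <<x |: J>>%g by exact: joing_idr.
apply/imsetP; exists s; first by rewrite inE sT genJ genS eqxx.
apply/setP=> t; rewrite orbitJ inE.
apply/andP/imsetP=> [[tT /eqP gent] | [p pP ->]].
  have genX : <<t |: J>>%g = W by rewrite -genJ.
  have [lev norm] :=
    generating_root_level rPhi rhoM rho_isom simpleS rT Phi_refl indep tT genX.
  set q := average _ _ _ in lev.
  have [a ta [qa na]] : exists2 a, root_of form Phi rho t a &
      form q a = form q (r s) /\ form a a = form (r s) (r s).
    have [rtP rt] := rT t tT; case: lev => lev; first by exists (r t).
    exists (- r t); last by rewrite !dotNr dotNl opprK lev opprK.
    by split=> [|v]; [exact: root_opp rPhi _ rtP | rewrite rt reflN].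
  have [rsP _] := rT s sT; have [aP ta'] := ta.
  have [w wP wa] :=
    level_roots_conj rPhi rhoM rho_isom simpleS rT Phi_refl indep
    rsP aP (erefl _) qa (esym na).
  have wW := subsetP sPW w wP.
  exists (w^-1)%g; first by rewrite groupV.
  apply: rho_inj (subsetP sTW t tT) (groupJ sW (groupVr wW)) _.
  apply/lfunP=> v; rewrite ta' -wa.
  have waP : rho w (r s) \in Phi by rewrite wa.
  by have [_ ->] := root_of_conj rhoM rho_isom sW wW waP (rT s sT).
have pW := subsetP sPW p pP.
split; first by rewrite defT memJ_class_support ?setU11.
set Q := <<_>>%g; have JQ : <<J>>%g \subset Q by rewrite sub_gen ?subsetUr.
rewrite eqEsubset gen_subG subUset sub1set groupJ // sPW -genS gen_subG subUset.
rewrite sub1set (subset_trans (subset_gen J) JQ) andbT.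
by rewrite -(groupJr _ (subsetP JQ p pP)) mem_gen ?setU11.
Qed.
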